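(* Let $R\subseteq[-\infty,\infty]$ be an interval. Let $L$ be a lattice that is rank supersolvable with respect to an $R$-grading $\rho:L\to R$, with chief chain $\mathbf{m}=\{m_\lambda:\lambda\in R\}$, where $\rho(m_\lambda)=\lambda$. Suppose further that the following conditions are met for every maximal chain $\mathbf{c}$ of $L$, every $\lambda_0\in R$, and every $z\in L$ (suprema and infima are taken in $L$): $$\sup\{m_{\lambda_0}\wedge c: c\in\mathbf{c},\ \rho(c)<\infty\}=m_{\lambda_0},\qquad \inf\{m_{\lambda_0}\vee c: c\in\mathbf{c},\ \rho(c)>-\infty\}=m_{\lambda_0},$$ $$\sup\{m_{\lambda}\wedge z:\lambda\in R,\ \lambda<\infty\}=z,\qquad \inf\{m_{\lambda}\vee z:\lambda\in R,\ \lambda>-\infty\}=z.$$ If $A$ is an antichain cutset for $L$, then there is some grading $\sigma$ of $L$ under which $A$ is a level set.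
   Context: For $R\subseteq[-\infty,\infty]$, an $R$-grading (or $R$-rank function) of a poset $L$ is a function $L\to R$ whose restriction to every maximal chain of $L$ is an order isomorphism onto $R$. A grading of $L$ is an $R'$-grading for some $R'\subseteq[-\infty,\infty]$. A level set of a grading $\sigma$ is a set of the form $\{x\in L:\sigma(x)=r\}$. Given a lattice $L$ with an $R$-grading $\rho$, an element $m\in L$ is rank modular (with respect to $\rho$) if $\rho(x\vee m)+\rho(x\wedge m)=\rho(x)+\rho(m)$ for every $x\in L$; equivalently, for every $x$ incomparable with $m$. (For $x$ comparable with $m$ the relation counts as holding automatically, even if ranks are infinite; for $x$ incomparable with $m$ it is an equality of extended reals in which no indeterminate form $\infty+(-\infty)$ is allowed to occur.) The lattice $L$ is rank supersolvable with respect to $\rho$ if it has a maximal chain consisting of rank modular elements, called a chief chain. An antichain cutset in $L$ is an antichain $A\subseteq L$ such that every maximal chain of $L$ has nonempty intersection with $A$. *)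

(* Defs.v *)
From mathcomp Require Import all_boot all_order all_algebra.
From mathcomp Require Import boolp classical_sets functions reals constructive_ereal.

Set Implicit Arguments.
Unset Strict Implicit.
Unset Printing Implicit Defensive.

Import Order.TTheory GRing.Theory Num.Theory.

Local Open Scope classical_set_scope.
Local Open Scope order_scope.

(* The analysis library has [is_interval] only over a numDomainType, which
   excludes the extended reals. *)
Definition ereal_interval (K : realType) (R : set (\bar K)) : Prop :=
  forall x y : \bar K, R x -> R y -> forall z : \bar K, x <= z <= y -> R z.

Definition chain d (P : porderType d) (C : set P) : Prop :=
  total_on C (fun x y => x <= y).

Definition maximal_chain d (P : porderType d) (C : set P) : Prop :=
  chain C /\ forall D : set P, chain D -> C `<=` D -> D = C.

Definition antichain d (P : porderType d) (A : set P) : Prop :=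
  forall x y : P, A x -> A y -> x <= y -> x = y.

Definition antichain_cutset d (P : porderType d) (A : set P) : Prop :=
  antichain A /\ forall C : set P, maximal_chain C -> (C `&` A)%classic !=set0.

Definition order_isomorphism_on d (P : porderType d) (K : realType)
    (C : set P) (R : set (\bar K)) (rho : P -> \bar K) : Prop :=
  set_bij C R rho /\
  forall x y : P, C x -> C y -> (rho x <= rho y) = (x <= y).

Definition R_grading d (P : porderType d) (K : realType) (R : set (\bar K))
    (rho : P -> \bar K) : Prop :=
  (forall x : P, R (rho x)) /\
  forall C : set P, maximal_chain C -> order_isomorphism_on C R rho.

Definition grading d (P : porderType d) (K : realType)
    (sigma : P -> \bar K) : Prop :=
  exists R' : set (\bar K), R_grading R' sigma.

Definition level_set (T : Type) (K : realType) (sigma : T -> \bar K)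
    (A : set T) : Prop :=
  exists r : \bar K, A = [set x | sigma x = r].

(* The library gives [+oo + -oo] a junk value; the two [+?] conditions say that
   neither sum is an indeterminate form.  Elements comparable with [m] impose
   no condition, even at infinite ranks. *)
Definition rank_modular d (L : latticeType d) (K : realType)
    (rho : L -> \bar K) (m : L) : Prop :=
  forall x : L, x >< m ->
    [/\ (rho (x `|` m) +? rho (x `&` m))%E,
        (rho x +? rho m)%E &
        (rho (x `|` m) + rho (x `&` m) = rho x + rho m)%E].

(* [L] is rank supersolvable with respect to [rho] when some [M] is a chief
   chain. *)
Definition chief_chain d (L : latticeType d) (K : realType)
    (rho : L -> \bar K) (M : set L) : Prop :=
  maximal_chain M /\ forall m : L, M m -> rank_modular rho m.

(* Main.v *)
Require Import Defs.
From mathcomp Require Import all_boot all_order all_algebra.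
From mathcomp Require Import boolp classical_sets functions reals constructive_ereal.
From mathcomp Require Import lra.

(** A mathematician would argue as follows.  Call [D] the set of elements below
    some element of [A] and [U] the set of those above some element of [A].
    Since every maximal chain meets the antichain [A], every element lies in
    [D] or [U], and [D] and [U] meet exactly in [A].  If [A] consists of the
    bottom or of the top element, it is a level set of [rho] itself.  Otherwise
    all elements of [A] have finite rank, and for [x] of finite rank one looks
    at the chain of the joins of [x] with the chief elements [w].  If [x] is in [D],
    this chain rises from [x] and crosses [A], and

      s x = inf (rho (x `|` w) - rho x), over the [w] with [x `|` w] in [U],

    is the rank that is gained on the way from [x] to [A] along this chain.

    Rank modularity makes [rho (x `|` w)] grow with slope at most 1 both in [w]
    and in [x].  This gives all that is needed.  The function [s] vanishes on
    [U], is antitone, and is strictly so below [A]: when [x < y], either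
    [y `&` w] has larger rank than [x `&` w], so that [y `|` w] is reached at
    a smaller cost, or [y `|` w] lies strictly above [x `|` w], so that [y]
    meets [A] for a smaller [w] ([climb_strict]).  It has no jumps along maximal
    chains ([climb_right], [climb_left]), since a jump would produce a chain that
    misses [A].  And it takes the same values on all maximal chains
    ([climb_onto]), because by the limit conditions every maximal chain
    gets as close to the bottom of the lattice as the chief chain does
    ([climb_cofinal]).

    The same construction in the dual lattice gives a function [t], which
    vanishes on [D] and measures the descent to [A].  Then [sigma = t - s], which
    keeps the infinite ranks of [rho], is strictly increasing and takes the
    same values on all maximal chains, so it is a grading; it vanishes exactly
    on [A]. *)

Set Implicit Arguments.
Unset Strict Implicit.
Unset Printing Implicit Defensive.

Import Order.TTheory GRing.Theory Num.Theory.

Local Open Scope classical_set_scope.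
Local Open Scope order_scope.

(** * Chains and antichain cutsets *)

Section ChainsAndCutsets.
Context {d : Order.disp_t} {P : porderType d}.

(** Hausdorff's maximality principle for chains that contain [X]. *)
Lemma chain_extends (X : set P) :
  chain X -> exists2 C : set P, maximal_chain C & X `<=` C.
Proof.
move=> chX.
have [|B [chB Bmax]] := @Zorn_bigcup P [set Y | chain (X `|` Y)].
  move=> F FQ Ftot s t [Xs|[Y FY Ys]] [Xt|[Z FZ Zt]].
  - exact: chX.
  - by apply: (FQ _ FZ); [left|right].
  - by apply: (FQ _ FY); [right|left].
  - have [YZ|ZY] := Ftot _ _ FY FZ.
      by apply: (FQ _ FZ); right => //; exact: YZ.
    by apply: (FQ _ FY); right => //; exact: ZY.
exists (X `|` B)%classic; last exact: subsetUl.
split=> // D chD XBD; apply/seteqP; split=> // x Dx; apply: contrapT => nx.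
have BD : B `<` D.
  split; last by move=> DB; apply: nx; right; exact: DB.
  by move=> y By; apply: XBD; right.
have XD : X `<=` D by move=> y Xy; apply: XBD; left.
by apply: (Bmax _ BD); rewrite /= (setUidr XD).
Qed.

Lemma chain_pair (x y : P) : x <= y -> chain [set x; y].
Proof. by move=> xy s t [->|->] [->|->]; rewrite ?lexx ?xy; [left|left|right|left]. Qed.

Definition above (A : set P) (x : P) : Prop := exists2 a, A a & a <= x.
Definition below (A : set P) (x : P) : Prop := exists2 a, A a & x <= a.

Lemma above_le (A : set P) x y : x <= y -> above A x -> above A y.
Proof. by move=> xy [a Aa ax]; exists a => //; exact: le_trans xy. Qed.

Lemma below_le (A : set P) x y : x <= y -> below A y -> below A x.
Proof. by move=> xy [a Aa ya]; exists a => //; exact: le_trans ya. Qed.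

Lemma above_below (A : set P) x : antichain A -> above A x -> below A x -> A x.
Proof.
move=> anti [a Aa ax] [b Ab xb].
have ab := anti _ _ Aa Ab (le_trans ax xb); rewrite -ab in xb.
suff -> : x = a by [].
by apply/eqP; rewrite eq_le xb ax.
Qed.

(** The crossing of [X] with the cutset: the element at which a maximal chain
    through [X] meets [A].  It need not belong to [X], but it separates the
    elements of [X] above [A] from the others.  Most arguments below build a
    suitable [X] and compare ranks with this element. *)
Lemma cut_element (A X : set P) : antichain_cutset A -> chain X ->
  exists e, [/\ A e,
    forall x, X x -> above A x -> e <= x,
    forall x, X x -> ~ above A x -> x <= e,
    forall x, X x -> below A x -> x <= e &
    forall x, X x -> ~ below A x -> e <= x].
Proof.
move=> [anti cut] /chain_extends [C Cmax XC].
have [e [Ce Ae]] := cut C Cmax; exists e; split=> // x Xx.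
- have [//|xe [a Aa ax]] := Cmax.1 _ _ Ce (XC _ Xx).
  by rewrite -(anti _ _ Aa Ae (le_trans ax xe)).
- by move=> nx; have [ex|//] := Cmax.1 _ _ Ce (XC _ Xx); case: nx; exists e.
- have [ex [a Aa xa]|//] := Cmax.1 _ _ Ce (XC _ Xx).
  by rewrite (anti _ _ Ae Aa (le_trans ex xa)).
- by move=> nx; have [//|ex] := Cmax.1 _ _ Ce (XC _ Xx); case: nx; exists e.
Qed.

Lemma above_or_below (A : set P) x : antichain_cutset A -> above A x \/ below A x.
Proof.
move=> cutA; have [|e [Ae _ h _ _]] := @cut_element A [set x] cutA.
  by move=> s t -> ->; left.
have [|nx] := pselect (above A x); first by left.
by right; exists e => //; exact: h.
Qed.

End ChainsAndCutsets.

(** * The data near the cutset *)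

(** A lattice with a chief chain [M] and a cutset [A], described through real
    numbers alone: [F] stands for the elements of finite rank and [r] for their
    rank, so that ranks can be subtracted.  The list of conditions is
    self-dual, so that each fact on the ascent to [A] is also one on the descent
    ([cut_frame_dual]). *)
Record cut_frame {d : Order.disp_t} {L : latticeType d} {K : realType}
    (F : set L) (r : L -> K) (M A : set L) : Prop := CutFrame {
  rank_lt : forall x y, F x -> F y -> x < y -> r x < r y;
  rank_onto : forall C x, maximal_chain C -> F x ->
    exists c, [/\ C c, F c & r c = r x];
  rank_between : forall C x y v, maximal_chain C -> C x -> F x -> C y -> F y ->
    r x <= v -> v <= r y -> exists z, [/\ C z, F z & r z = v];
  chief_maximal : maximal_chain M;
  rank_modularity : forall x w, F x -> M w -> F w ->
    [/\ F (x `|` w), F (x `&` w) &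
        (r (x `|` w) + r (x `&` w) = r x + r w)%R];
  cutsetA : antichain_cutset A;
  cutset_finite : A `<=` F;
  cutset_nbot : forall a, A a -> exists x, ~ a <= x;
  cutset_ntop : forall a, A a -> exists x, ~ x <= a;
  chief_inf : forall z e,
    (forall w, M w -> F w -> e <= z `|` w) -> e <= z;
  chief_sup : forall z e,
    (forall w, M w -> F w -> z `&` w <= e) -> z <= e;
  chain_inf : forall C w e, maximal_chain C -> M w -> F w ->
    (forall c, C c -> F c -> e <= w `|` c) -> e <= w;
  chain_sup : forall C w e, maximal_chain C -> M w -> F w ->
    (forall c, C c -> F c -> w `&` c <= e) -> w <= e }.

Lemma maximal_chain_dual d (P : porderType d) (C : set P) :
  maximal_chain C -> @maximal_chain _ P^d C.
Proof.
move=> [chC Cmax]; split; first by move=> s t Cs Ct; have [] := chC _ _ Ct Cs; [left|right].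
by move=> D chD; apply: Cmax => s t Ds Dt; have [] := chD _ _ Dt Ds; [left|right].
Qed.

Lemma maximal_chain_undual d (P : porderType d) (C : set P) :
  @maximal_chain _ P^d C -> maximal_chain C.
Proof.
move=> [chC Cmax]; split; first by move=> s t Cs Ct; have [] := chC _ _ Ct Cs; [left|right].
by move=> D chD; apply: Cmax => s t Ds Dt; have [] := chD _ _ Dt Ds; [left|right].
Qed.

Lemma cut_frame_dual d (L : latticeType d) (K : realType)
    (F : set L) (r : L -> K) (M A : set L) :
  cut_frame F r M A -> @cut_frame _ L^d K F (fun x => - r x)%R M A.
Proof.
case=> lt onto btw Mmax rmod [anti cut] Afin nbot ntop cinf csup chinf chsup; split.
- by move=> x y Fx Fy; rewrite ltEdual => /(lt _ _ Fy Fx); rewrite ltrN2.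
- move=> C x /maximal_chain_undual Cm Fx.
  by have [c [? ? e]] := onto _ _ Cm Fx; exists c; split=> //; rewrite e.
- move=> C x y v /maximal_chain_undual Cm Cx Fx Cy Fy xv vy.
  have [||z [? ? e]] := btw C y x (- v)%R Cm Cy Fy Cx Fx; [lra|lra|].
  by exists z; split=> //; rewrite e opprK.
- exact: maximal_chain_dual.
- move=> x w Fx Mw Fw; have [? ? e] := rmod x w Fx Mw Fw; split=> //.
  rewrite joinEdual meetEdual; lra.
- split; last by move=> C /maximal_chain_undual; exact: cut.
  by move=> x y Ax Ay yx; apply/esym/anti.
- by [].
- exact: ntop.
- exact: nbot.
- exact: csup.
- exact: cinf.
- by move=> C w e /maximal_chain_undual; exact: chsup.
- by move=> C w e /maximal_chain_undual; exact: chinf.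
Qed.

(** * The rank gained on the way up to the cutset *)

Definition climb {d : Order.disp_t} {L : latticeType d} {K : realType}
    (F : set L) (r : L -> K) (M A : set L) (x : L) : K :=
  inf [set r (x `|` w) - r x | w in [set w | [/\ M w, F w & above A (x `|` w)]]]%R.

Section Climb.
Context {d : Order.disp_t} {L : latticeType d} {K : realType}.
Variables (F : set L) (r : L -> K) (M A : set L).
Hypothesis fr : cut_frame F r M A.
Local Open Scope ring_scope.
Local Open Scope order_scope.

Let s := climb F r M A.

Lemma rank_le x y : F x -> F y -> x <= y -> r x <= r y.
Proof.
move=> Fx Fy; rewrite le_eqVlt => /orP[/eqP->//|xy].
exact/ltW/(rank_lt fr).
Qed.

Lemma rank_inj x y : F x -> F y -> x <= y -> r y <= r x -> x = y.
Proof.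
move=> Fx Fy; rewrite le_eqVlt => /orP[/eqP->//|/(rank_lt fr Fx Fy)].
by rewrite ltNge => /negbTE ->.
Qed.

Lemma chain_rank_lt C x y : chain C -> C x -> F x -> C y -> F y ->
  r x < r y -> x < y.
Proof.
move=> chC Cx Fx Cy Fy lt; have [xy|yx] := chC _ _ Cx Cy.
  by rewrite lt_neqAle xy andbT; apply: contraTneq lt => ->; rewrite ltxx.
by move: (rank_le Fy Fx yx); rewrite leNgt lt.
Qed.

Lemma chain_rank_le C x y : chain C -> C x -> F x -> C y -> F y ->
  r x <= r y -> x <= y.
Proof.
move=> chC Cx Fx Cy Fy le; have [//|yx] := chC _ _ Cx Cy.
by rewrite (rank_inj Fy Fx yx le).
Qed.

Lemma joinF x w : F x -> M w -> F w -> F (x `|` w).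
Proof. by move=> Fx Mw Fw; have [] := rank_modularity fr Fx Mw Fw. Qed.

(** Modularity writes the rank of [x `|` w] as [r x + r w - r (x `&` w)], and the
    last term grows too; hence joins move no faster than their arguments. *)
Lemma rank_join_chief x w w' : F x -> M w -> F w -> M w' -> F w' -> w <= w' ->
  r (x `|` w') - r (x `|` w) <= r w' - r w.
Proof.
move=> Fx Mw Fw Mw' Fw' ww'.
have [_ Fm e] := rank_modularity fr Fx Mw Fw.
have [_ Fm' e'] := rank_modularity fr Fx Mw' Fw'.
have := rank_le Fm Fm' (leI2 (lexx x) ww'); lra.
Qed.

Lemma rank_join_elt x y w : F x -> F y -> M w -> F w -> x <= y ->
  r (y `|` w) - r (x `|` w) <= r y - r x.
Proof.
move=> Fx Fy Mw Fw xy.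
have [_ Fm e] := rank_modularity fr Fx Mw Fw.
have [_ Fm' e'] := rank_modularity fr Fy Mw Fw.
have := rank_le Fm Fm' (leI2 xy (lexx w)); lra.
Qed.

Lemma chief_cut : exists w, [/\ M w, F w & A w].
Proof.
have [w [Mw Aw]] := (cutsetA fr).2 _ (chief_maximal fr).
by exists w; split=> //; exact: (cutset_finite fr).
Qed.

(** Completeness of the reals, transported to a maximal chain by its rank. *)
Lemma chain_cut_point C (V : L -> Prop) x y : maximal_chain C ->
  C x -> F x -> C y -> F y -> ~ V x -> V y ->
  (forall u v, F u -> F v -> u <= v -> V u -> V v) ->
  exists z, [/\ C z, F z, x <= z, z <= y &
    forall u, C u -> F u -> (u < z -> ~ V u) /\ (z < u -> V u)].
Proof.
move=> Cm Cx Fx Cy Fy nVx Vy Vup.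
pose S := [set r u | u in [set u | [/\ C u, F u & ~ V u]]].
have Sx : S (r x) by exists x.
have Suby : ubound S (r y).
  move=> _ [u [Cu Fu nVu] <-]; rewrite leNgt; apply/negP => yu.
  by apply: nVu; apply: (Vup y) => //; apply/ltW/(chain_rank_lt Cm.1).
have Sub : has_ubound S by exists (r y).
have xS : r x <= sup S by exact: ub_le_sup.
have Sy : sup S <= r y by apply: ge_sup => //; exists (r x).
have [z [Cz Fz rz]] := rank_between fr Cm Cx Fx Cy Fy xS Sy.
exists z; split=> //.
- by apply: (chain_rank_le Cm.1) => //; rewrite rz.
- by apply: (chain_rank_le Cm.1) => //; rewrite rz.
move=> u Cu Fu; split=> [uz Vu|zu].
  (* Below the supremum there is room for a further element outside [V]. *)
  have Slt : 0 < sup S - r u by rewrite subr_gt0 -rz; exact: (rank_lt fr).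
  have hS : has_sup S by split=> //; exists (r x).
  have [_ [u' [Cu' Fu' nVu'] <-]] := sup_adherent Slt hS.
  move=> lt; apply: nVu'; apply: (Vup u) => //; apply/ltW/(chain_rank_lt Cm.1) => //.
  lra.
apply: contrapT => nVu.
have : r u <= sup S by apply: ub_le_sup => //; exists u.
by rewrite leNgt -rz (rank_lt fr Fz Fu zu).
Qed.

(** The cut point may fall on either side of [V]; this form does not depend on
    the side and is the one to combine with [rank_join_chief]. *)
Lemma chief_cut_close (V : L -> Prop) x y eps : 0 < eps ->
  M x -> F x -> M y -> F y -> ~ V x -> V y ->
  (forall u v, F u -> F v -> u <= v -> V u -> V v) ->
  exists u v, [/\ M u /\ F u, M v /\ F v, ~ V u, V v & r v - r u < eps].
Proof.
move=> eps0 Mx Fx My Fy nVx Vy Vup.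
have Mm := chief_maximal fr.
have [z [Mz Fz xz zy zP]] := chain_cut_point Mm Mx Fx My Fy nVx Vy Vup.
have [Vz|nVz] := pselect (V z).
  have xltz : x < z.
    by rewrite lt_neqAle xz andbT; apply/eqP => e; apply: nVx; rewrite e.
  have rxz := rank_lt fr Fx Fz xltz.
  have [u [Mu Fu ru]] : exists u, [/\ M u, F u & r u = Num.max (r x) (r z - eps / 2)].
    apply: (rank_between fr Mm Mx Fx Mz Fz); first by rewrite le_max lexx.
    by rewrite ge_max; apply/andP; split; lra.
  exists u, z; split=> //.
    apply: (zP u Mu Fu).1; apply: (chain_rank_lt Mm.1) => //.
    by rewrite ru gt_max; apply/andP; split; lra.
  have : r z - eps / 2 <= r u by rewrite ru le_max lexx orbT.
  lra.
have zlty : z < y.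
  by rewrite lt_neqAle zy andbT; apply/eqP => e; apply: nVz; rewrite e.
have rzy := rank_lt fr Fz Fy zlty.
have [u [Mu Fu ru]] : exists u, [/\ M u, F u & r u = Num.min (r y) (r z + eps / 2)].
  apply: (rank_between fr Mm Mz Fz My Fy); last by rewrite ge_min lexx.
  by rewrite le_min; apply/andP; split; lra.
exists z, u; split=> //.
  apply: (zP u Mu Fu).2; apply: (chain_rank_lt Mm.1) => //.
  by rewrite ru lt_min; apply/andP; split; lra.
have : r u <= r z + eps / 2 by rewrite ru ge_min lexx orbT.
lra.
Qed.

Lemma chief_joins_chain x : chain [set (x `|` w)%O | w in M `&` F].
Proof.
move=> _ _ [u [Mu _] <-] [v [Mv _] <-].
by have [uv|vu] := (chief_maximal fr).1 _ _ Mu Mv; [left|right]; exact: leU2.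
Qed.

Lemma chief_joins_chain_bottom x :
  chain (x |` [set (x `|` w)%O | w in M `&` F])%classic.
Proof.
move=> u v [->|Xu] [->|Xv]; first by left.
- by left; case: Xv => w _ <-; exact: leUl.
- by right; case: Xu => w _ <-; exact: leUl.
- exact: (@chief_joins_chain x).
Qed.

(** If all joins of [x] with chief elements stayed [eps] above [x] in rank, an
    element of intermediate rank on a chain through them would be a lower bound
    of these joins that is not below [x]. *)
Lemma join_chief_near x eps : F x -> 0 < eps ->
  exists w, [/\ M w, F w & r (x `|` w) < r x + eps].
Proof.
move=> Fx eps0; apply: contrapT => far.
have far' w : M w -> F w -> r x + eps <= r (x `|` w).
  by move=> Mw Fw; rewrite leNgt; apply/negP => h; apply: far; exists w.
have [C Cm XC] := chain_extends (@chief_joins_chain_bottom x).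
have Cx : C x by apply: XC; left.
have Cj w : M w -> F w -> C (x `|` w) by move=> Mw Fw; apply: XC; right; exists w.
have [w0 [Mw0 Fw0 _]] := chief_cut.
have [||z [Cz Fz rz]] := rank_between fr (v := r x + eps) Cm Cx Fx
  (Cj _ Mw0 Fw0) (joinF Fx Mw0 Fw0); [lra|exact: far'|].
have zx : z <= x.
  apply: (chief_inf fr) => w Mw Fw; apply: (chain_rank_le Cm.1) => //.
  - exact: Cj.
  - exact: joinF.
  - by rewrite rz; exact: far'.
have := rank_le Fz Fx zx; lra.
Qed.

Lemma ex_join_not_above x : F x -> ~ above A x ->
  exists w, [/\ M w, F w & ~ above A (x `|` w)].
Proof.
move=> Fx nx; apply: contrapT => all.
have [e [Ae h _ _ _]] := cut_element (cutsetA fr) (@chief_joins_chain x).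
apply: nx; exists e => //; apply: (chief_inf fr) => w Mw Fw.
apply: h; first by exists w.
by apply: contrapT => nw; apply: all; exists w.
Qed.

(** Otherwise the element at which the chain of joins crosses [A] would dominate
    the whole chief chain, and be the top element. *)
Lemma ex_join_not_below x : exists w, [/\ M w, F w & ~ below A (x `|` w)].
Proof.
apply: contrapT => all.
have [e [Ae _ _ h _]] := cut_element (cutsetA fr) (@chief_joins_chain x).
have [y] := cutset_ntop fr Ae; apply.
apply: (chief_sup fr) => w Mw Fw; apply: (le_trans (leIr _ _)).
apply: (le_trans (leUr w x)); apply: h; first by exists w.
by apply: contrapT => nw; apply: all; exists w.
Qed.

Lemma chief_cut_above x : exists w, [/\ M w, F w & above A (x `|` w)].
Proof.
have [w [Mw Fw Aw]] := chief_cut; exists w; split=> //.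
by exists w => //; exact: leUr.
Qed.

(** The chain of the joins of [x] with the chief elements actually meets [A]: at
    the cut point [z] between the joins outside and inside [U], the rank of
    [x `|` z] and that of the crossing element differ by less than any [eps]. *)
Lemma join_hits_cutset x : F x -> ~ above A x ->
  exists w, [/\ M w, F w & A (x `|` w)].
Proof.
move=> Fx nx.
have [w0 [Mw0 Fw0 nw0]] := ex_join_not_above Fx nx.
have [w1 [Mw1 Fw1 aw1]] := chief_cut_above x.
pose V w := above A (x `|` w).
have Vup u v : F u -> F v -> u <= v -> V u -> V v.
  by move=> _ _ uv; apply: above_le; exact: leU2.
have Mm := chief_maximal fr.
have [z [Mz Fz _ _ zP]] := chain_cut_point Mm Mw0 Fw0 Mw1 Fw1 nw0 aw1 Vup.
have [e [Ae hU hN _ _]] := cut_element (cutsetA fr) (@chief_joins_chain x).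
have Fe := cutset_finite fr Ae.
have Fxz := joinF Fx Mz Fz.
have sq eps : 0 < eps -> `|r e - r (x `|` z)| <= eps.
  move=> eps0.
  have [u [v [[Mu Fu] [Mv Fv] nVu Vv uv]]] :=
    chief_cut_close eps0 Mw0 Fw0 Mw1 Fw1 nw0 aw1 Vup.
  have uz : u <= z.
    have [//|zu] := Mm.1 _ _ Mu Mz; move: zu; rewrite le_eqVlt => /orP[/eqP->//|zu].
    by case: nVu; exact: (zP u Mu Fu).2.
  have zv : z <= v.
    have [//|vz] := Mm.1 _ _ Mz Mv; move: vz; rewrite le_eqVlt => /orP[/eqP->//|vz].
    by case: ((zP v Mv Fv).1 vz).
  have Fu' := joinF Fx Mu Fu; have Fv' := joinF Fx Mv Fv.
  have h1 := rank_le Fu' Fe (hN _ (ex_intro2 _ _ u (conj Mu Fu) erefl) nVu).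
  have h2 := rank_le Fe Fv' (hU _ (ex_intro2 _ _ v (conj Mv Fv) erefl) Vv).
  have h3 := rank_le Fu' Fxz (leU2 (lexx x) uz).
  have h4 := rank_le Fxz Fv' (leU2 (lexx x) zv).
  have h5 := rank_join_chief Fx Mu Fu Mv Fv (le_trans uz zv).
  rewrite ler_norml; apply/andP; split; lra.
have rE : r e = r (x `|` z).
  apply/eqP; rewrite -subr_eq0 -normr_le0; apply/ler_addgt0Pr => eps eps0.
  by rewrite add0r; exact: sq.
exists z; split=> //; have Xz : [set (x `|` w)%O | w in M `&` F] (x `|` z) by exists z.
have [az|naz] := pselect (above A (x `|` z)).
  by rewrite -(rank_inj Fe Fxz (hU _ Xz az)) // rE.
by rewrite (rank_inj Fxz Fe (hN _ Xz naz)) // rE.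
Qed.

Lemma climb_le x w : F x -> M w -> F w -> above A (x `|` w) ->
  s x <= r (x `|` w) - r x.
Proof.
move=> Fx Mw Fw aw; apply: ge_inf; last by exists w.
exists 0 => _ [u [Mu Fu _] <-]; rewrite subr_ge0.
exact: (rank_le Fx (joinF Fx Mu Fu) (leUl _ _)).
Qed.

Lemma climb_ge x v :
  (forall w, M w -> F w -> above A (x `|` w) -> v <= r (x `|` w) - r x) -> v <= s x.
Proof.
move=> h; apply: lb_le_inf; last by move=> _ [w [Mw Fw aw] <-]; exact: h.
have [w [Mw Fw aw]] := chief_cut_above x.
by exists (r (x `|` w) - r x), w.
Qed.

Lemma climb_ge0 x : F x -> 0 <= s x.
Proof.
move=> Fx; apply: climb_ge => w Mw Fw _; rewrite subr_ge0.
exact: (rank_le Fx (joinF Fx Mw Fw) (leUl _ _)).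
Qed.

(** A join in [D] lies below every join in [U] on the same chain.  So [climb] is
    confined between the gains of the joins in [D] and, by [climb_le], those of
    the joins in [U]. *)
Lemma climb_ge_below x w : F x -> M w -> F w -> below A (x `|` w) ->
  r (x `|` w) - r x <= s x.
Proof.
move=> Fx Mw Fw bw; apply: climb_ge => u Mu Fu au; rewrite lerD2r.
have Fxu := joinF Fx Mu Fu; have Fxw := joinF Fx Mw Fw.
have [wu|uw] := (chief_maximal fr).1 _ _ Mw Mu.
  exact/rank_le/leU2.
have le := leU2 (lexx x) uw.
have Aw := above_below (cutsetA fr).1 (above_le le au) bw.
have Au := above_below (cutsetA fr).1 au (below_le le bw).
by rewrite ((cutsetA fr).1 _ _ Au Aw le).
Qed.

Lemma not_above_below x : ~ above A x -> below A x.
Proof. by have [] := above_or_below x (cutsetA fr). Qed.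

Lemma climb_above x : F x -> above A x -> s x = 0.
Proof.
move=> Fx ax; apply/eqP; rewrite eq_le climb_ge0 // andbT.
apply/ler_addgt0Pr => eps eps0; rewrite add0r.
have [w [Mw Fw lt]] := join_chief_near Fx eps0.
have := climb_le Fx Mw Fw (above_le (leUl _ _) ax); lra.
Qed.

Lemma climb_anti x y : F x -> F y -> x <= y -> s y <= s x.
Proof.
move=> Fx Fy xy; apply: climb_ge => w Mw Fw aw.
have := climb_le Fy Mw Fw (above_le (leU2 xy (lexx w)) aw).
have := rank_join_elt Fx Fy Mw Fw xy; lra.
Qed.

Lemma climb_hit x w : F x -> M w -> F w -> A (x `|` w) -> s x = r (x `|` w) - r x.
Proof.
move=> Fx Mw Fw Aw; apply/eqP; rewrite eq_le climb_le ?climb_ge_below //.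
  by exists (x `|` w).
by exists (x `|` w).
Qed.

Lemma climb_strict x y : F x -> F y -> x < y -> below A y -> s y < s x.
Proof.
move=> Fx Fy xy [b Ab yb].
have nx : ~ above A x.
  move=> [a Aa ax]; have ab := (cutsetA fr).1 _ _ Aa Ab (le_trans ax (le_trans (ltW xy) yb)).
  by move: (lt_le_trans (le_lt_trans ax xy) yb); rewrite ab ltxx.
have [w [Mw Fw Aw]] := join_hits_cutset Fx nx.
have xw := leU2 (ltW xy) (lexx w).
have ayw : above A (y `|` w) by exists (x `|` w).
have sx := climb_hit Fx Mw Fw Aw.
have syle := climb_le Fy Mw Fw ayw.
have [Fxw Fxm ex] := rank_modularity fr Fx Mw Fw.
have [Fyw Fym ey] := rank_modularity fr Fy Mw Fw.
have rxy := rank_lt fr Fx Fy xy.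
(* [mle] separates the two sources of strictness: the meet or the join grows. *)
have mle := rank_le Fxm Fym (leI2 (ltW xy) (lexx w)).
have := mle; rewrite le_eqVlt => /orP[/eqP meq|]; last by lra.
have rlt : r (x `|` w) < r (y `|` w) by lra.
have sx0 : 0 < s x.
  rewrite sx subr_gt0; apply: (rank_lt fr) => //.
  rewrite lt_neqAle leUl andbT; apply/eqP => e; apply: nx.
  by exists x => //; rewrite e.
have [ay|nay] := pselect (above A y); first by rewrite climb_above.
have [u [Mu Fu Au]] := join_hits_cutset Fy nay.
have sy := climb_hit Fy Mu Fu Au.
have Fyu := joinF Fy Mu Fu.
suff : r (y `|` u) < r (y `|` w) by lra.
have [wu|uw] := (chief_maximal fr).1 _ _ Mw Mu.
  have e := (cutsetA fr).1 _ _ Aw Au (le_trans xw (leU2 (lexx y) wu)).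
  have : r (y `|` w) <= r (y `|` u) by exact/rank_le/leU2.
  by rewrite -e leNgt rlt.
apply: (rank_lt fr) => //; rewrite lt_neqAle leU2 // andbT.
apply/eqP => e; rewrite e in Au.
by move: rlt; rewrite ((cutsetA fr).1 _ _ Aw Au xw) ltxx.
Qed.

(** The bounds on [climb] are witnessed by a join strictly below [A] and by one
    strictly above [A] (in [climb_lt_witness]); strictness is what survives a
    small move of [z] along a chain. *)
Lemma climb_gt_witness z (v : K) : F z -> ~ above A z -> v < s z ->
  exists w, [/\ M w, F w, ~ above A (z `|` w) & v < r (z `|` w) - r z].
Proof.
move=> Fz nz vs.
have [w0 [Mw0 Fw0 nw0]] := ex_join_not_above Fz nz.
have [w1 [Mw1 Fw1 aw1]] := chief_cut_above z.
have eps0 : 0 < s z - v by lra.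
have [|u [w [[Mu Fu] [Mw Fw] nu aw lt]]] :=
  @chief_cut_close (fun w => above A (z `|` w)) _ _ _ eps0 Mw0 Fw0 Mw1 Fw1 nw0 aw1.
  by move=> a b _ _ ab; apply: above_le; exact: leU2.
exists u; split=> //.
have uw : u <= w.
  have [//|wu] := (chief_maximal fr).1 _ _ Mu Mw.
  by case: nu; apply: above_le aw; exact: leU2.
have := climb_le Fz Mw Fw aw.
have := rank_join_chief Fz Mu Fu Mw Fw uw; lra.
Qed.

Lemma climb_lt_witness z (v : K) : F z -> s z < v ->
  exists w, [/\ M w, F w, ~ below A (z `|` w) & r (z `|` w) - r z < v].
Proof.
move=> Fz sv; have s0 := climb_ge0 Fz.
have [[w0 [Mw0 Fw0 bw0]]|all] := pselect (exists w, [/\ M w, F w & below A (z `|` w)]).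
  have [w1 [Mw1 Fw1 nw1]] := ex_join_not_below z.
  have eps0 : 0 < v - s z by lra.
  have [||u [w [[Mu Fu] [Mw Fw] nnu nw lt]]] :=
    @chief_cut_close (fun w => ~ below A (z `|` w)) _ _ _ eps0 Mw0 Fw0 Mw1 Fw1 _ nw1.
  - exact.
  - by move=> a b _ _ ab h /(below_le (leU2 (lexx z) ab)).
  have bu : below A (z `|` u) by exact: contrapT.
  exists w; split=> //.
  have uw : u <= w.
    have [//|wu] := (chief_maximal fr).1 _ _ Mu Mw.
    by case: nw; apply: below_le bu; exact: leU2.
  have := climb_ge_below Fz Mu Fu bu.
  have := rank_join_chief Fz Mu Fu Mw Fw uw; lra.
(* Every join lies strictly above [A], and those nearest to [z] gain hardly any
   rank. *)
have v0 : 0 < v by lra.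
have [w [Mw Fw lt]] := join_chief_near Fz v0.
exists w; split=> //; last lra.
by move=> bw; apply: all; exists w.
Qed.

Lemma joins_chain (C : set L) w : chain C -> chain [set (c `|` w)%O | c in C].
Proof.
move=> chC _ _ [a Ca <-] [b Cb <-].
by have [ab|ba] := chC _ _ Ca Cb; [left|right]; exact: leU2.
Qed.

(** Take a join [z `|` w] that lies strictly below [A] and gains more than [v].
    If all [z' `|` w] with [z' > z] on the chain were above [A], the crossing
    element would be squeezed onto [z `|` w]. *)
Lemma climb_right C z y (v : K) : maximal_chain C -> C z -> F z -> C y -> F y -> z < y ->
  0 <= v -> v < s z -> exists z', [/\ C z', F z', z < z' & v < s z'].
Proof.
move=> Cm Cz Fz Cy Fy zy v0 vs; have rzy := rank_lt fr Fz Fy zy.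
have nz : ~ above A z by move=> /(climb_above Fz) e; move: vs; rewrite e ltNge v0.
have [w [Mw Fw nw vw]] := climb_gt_witness Fz nz vs.
have Fzw := joinF Fz Mw Fw.
have near (eps : K) t : C t -> F t -> z < t -> 0 < eps ->
    exists u, [/\ C u, F u, z < u, u <= t & r u < r z + eps].
  move=> Ct Ft zt eps0; have rzt := rank_lt fr Fz Ft zt.
  have [||u [Cu Fu ru]] := rank_between fr (v := Num.min (r t) (r z + eps / 2)) Cm Cz Fz Ct Ft.
  - by rewrite le_min; apply/andP; split; lra.
  - by rewrite ge_min lexx.
  exists u; split=> //.
  - apply: (chain_rank_lt Cm.1) => //; rewrite ru lt_min; apply/andP; split; lra.
  - by apply: (chain_rank_le Cm.1) => //; rewrite ru ge_min lexx.
  - have : r u <= r z + eps / 2 by rewrite ru ge_min lexx orbT.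
    lra.
have [t [Ct Ft zt nt]] : exists t, [/\ C t, F t, z < t & ~ above A (t `|` w)].
  apply: contrapT => all.
  have [e [Ae hU hN _ _]] := cut_element (cutsetA fr) (joins_chain (w:=w) Cm.1).
  have Fe := cutset_finite fr Ae.
  have ze : z `|` w <= e by apply: hN => //; exists z.
  have rze : r (z `|` w) < r e.
    apply: (rank_lt fr) => //; rewrite lt_neqAle ze andbT.
    by apply/eqP => h; apply: nw; exists e => //; rewrite h.
  have eps0 : 0 < r e - r (z `|` w) by lra.
  have [u [Cu Fu zu _ ru]] := near _ y Cy Fy zy eps0.
  have eu : e <= u `|` w.
    apply: hU; first by exists u.
    by apply: contrapT => nu; apply: all; exists u.
  have := rank_le Fe (joinF Fu Mw Fw) eu.
  have := rank_join_elt Fz Fu Mw Fw (ltW zu); lra.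
have eps0 : 0 < r (z `|` w) - r z - v by lra.
have [u [Cu Fu zu ut ru]] := near _ t Ct Ft zt eps0.
exists u; split=> //.
have bu : below A (u `|` w).
  by apply: (@below_le _ _ _ _ (t `|` w)); [exact: leU2|exact: not_above_below].
have := climb_ge_below Fu Mw Fw bu.
have := rank_le Fzw (joinF Fu Mw Fw) (leU2 (ltW zu) (lexx w)); lra.
Qed.

(** As in [climb_right], from a join [z `|` w] strictly above [A] that gains less
    than [v]. *)
Lemma climb_left C z x (v : K) : maximal_chain C -> C z -> F z -> C x -> F x -> x < z ->
  s z < v -> exists z', [/\ C z', F z', z' < z & s z' < v].
Proof.
move=> Cm Cz Fz Cx Fx xz sv; have rxz := rank_lt fr Fx Fz xz.
have [w [Mw Fw nw wv]] := climb_lt_witness Fz sv.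
have Fzw := joinF Fz Mw Fw.
have near (eps : K) t : C t -> F t -> t < z -> 0 < eps ->
    exists u, [/\ C u, F u, u < z, t <= u & r z - eps < r u].
  move=> Ct Ft tz eps0; have rtz := rank_lt fr Ft Fz tz.
  have [||u [Cu Fu ru]] := rank_between fr (v := Num.max (r t) (r z - eps / 2)) Cm Ct Ft Cz Fz.
  - by rewrite le_max lexx.
  - by rewrite ge_max; apply/andP; split; lra.
  exists u; split=> //.
  - apply: (chain_rank_lt Cm.1) => //; rewrite ru gt_max; apply/andP; split; lra.
  - by apply: (chain_rank_le Cm.1) => //; rewrite ru le_max lexx.
  - have : r z - eps / 2 <= r u by rewrite ru le_max lexx orbT.
    lra.
have [t [Ct Ft tz atw]] : exists t, [/\ C t, F t, t < z & above A (t `|` w)].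
  apply: contrapT => all.
  have [e [Ae _ hN _ hB]] := cut_element (cutsetA fr) (joins_chain (w:=w) Cm.1).
  have Fe := cutset_finite fr Ae.
  have ez : e <= z `|` w by apply: hB => //; exists z.
  have rez : r e < r (z `|` w).
    apply: (rank_lt fr) => //; rewrite lt_neqAle ez andbT.
    by apply/eqP => h; apply: nw; exists e => //; rewrite h.
  have eps0 : 0 < r (z `|` w) - r e by lra.
  have [u [Cu Fu uz _ ru]] := near _ x Cx Fx xz eps0.
  have ue : u `|` w <= e.
    apply: hN; first by exists u.
    by move=> au; apply: all; exists u.
  have := rank_le (joinF Fu Mw Fw) Fe ue.
  have := rank_join_elt Fu Fz Mw Fw (ltW uz); lra.
have eps0 : 0 < v - (r (z `|` w) - r z) by lra.
have [u [Cu Fu uz tu ru]] := near _ t Ct Ft tz eps0.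
exists u; split=> //.
have := climb_le Fu Mw Fw (above_le (leU2 tu (lexx w)) atw).
have := rank_le (joinF Fu Mw Fw) Fzw (leU2 (ltW uz) (lexx w)); lra.
Qed.

Lemma climb_ivt C x y (v : K) : maximal_chain C -> C x -> F x -> C y -> F y ->
  0 <= v -> s y < v -> v <= s x -> exists z, [/\ C z, F z & s z = v].
Proof.
move=> Cm Cx Fx Cy Fy v0 yv vx.
have nVx : ~ s x < v by rewrite ltNge vx.
have Vup a b : F a -> F b -> a <= b -> s a < v -> s b < v.
  by move=> Fa Fb ab; apply: le_lt_trans; exact: climb_anti.
have [z [Cz Fz xz zy zP]] := chain_cut_point Cm Cx Fx Cy Fy nVx yv Vup.
exists z; split=> //; apply/eqP; case: ltgtP => // [zv|vz].
  have xltz : x < z.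
    by rewrite lt_neqAle xz andbT; apply/eqP => e; apply: nVx; rewrite e.
  have [u [Cu Fu uz uv]] := climb_left Cm Cz Fz Cx Fx xltz zv.
  by case: ((zP u Cu Fu).1 uz).
have zlty : z < y.
  rewrite lt_neqAle zy andbT; apply/eqP => e.
  by move: yv; rewrite -e ltNge (ltW vz).
have [u [Cu Fu zu vu]] := climb_right Cm Cz Fz Cy Fy zlty v0 vz.
by have := (zP u Cu Fu).2 zu; rewrite ltNge (ltW vu).
Qed.

(** The rank gained from [x] is at most [r w - r (x `&` w)] for the chief
    element [w] in [A].  Far down on [C], an element [c] has rank below that of
    [x `&` w] by some margin, while [A] is reached from [c] only beyond a chief
    element [w'] that is lower than [w] by no more than this margin; the gain
    from [c] is then at least [r w' - r c].  If [C] has no element of finite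
    rank below that of [x `&` w], its lowest one is below [x]. *)
Lemma climb_cofinal C x : maximal_chain C -> F x ->
  exists c, [/\ C c, F c & s x <= s c].
Proof.
move=> Cm Fx; have [w [Mw Fw Aw]] := chief_cut.
have sx : s x <= r (x `|` w) - r x.
  by apply: climb_le => //; exists w => //; exact: leUr.
have [Fxw Fxm ex] := rank_modularity fr Fx Mw Fw.
have mw := rank_le Fxm Fw (leIr _ _).
have [c0 [Cc0 Fc0 rc0]] := rank_onto fr Cm Fxm.
have [[c1 [Cc1 Fc1 c10]]|min] := pselect (exists c, [/\ C c, F c & c < c0]); last first.
  have c0min c : C c -> F c -> c0 <= c.
    move=> Cc Fc; have [//|cc0] := Cm.1 _ _ Cc0 Cc.
    move: cc0; rewrite le_eqVlt => /orP[/eqP->//|lt].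
    by case: min; exists c.
  have c0M u : M u -> F u -> c0 <= u.
    move=> Mu Fu; apply: (chain_inf fr Cm Mu Fu) => c Cc Fc.
    exact: le_trans (c0min _ Cc Fc) (leUr _ _).
  exists c0; split=> //; apply: climb_anti => //.
  apply: (chief_inf fr) => u Mu Fu; exact: le_trans (c0M _ Mu Fu) (leUr _ _).
have r10 := rank_lt fr Fc1 Fc0 c10.
(* The margin is [r c0 - r c1]; the chief element [m1] makes room for [w']. *)
have [m1 [Mm1 Fm1 rm1]] := rank_onto fr (chief_maximal fr) Fc1.
have [||w' [Mw' Fw' rw']] := rank_between fr (v := r w - (r c0 - r c1))
  (chief_maximal fr) Mm1 Fm1 Mw Fw; [lra|lra|].
have w'w : w' < w by apply: (chain_rank_lt (chief_maximal fr).1) => //; lra.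
have nw' : ~ above A w'.
  move=> [a Aa aw']; have e := (cutsetA fr).1 _ _ Aa Aw (le_trans aw' (ltW w'w)).
  by move: (le_lt_trans aw' w'w); rewrite e ltxx.
(* Otherwise the crossing element for the chain of the [c `|` w'] would be a lower
   bound of them, hence below [w'], by the limit condition on [C]. *)
have [c2 [Cc2 Fc2 nc2]] : exists c, [/\ C c, F c & ~ above A (c `|` w')].
  apply: contrapT => all.
  have [e [Ae hU _ _ _]] := cut_element (cutsetA fr) (joins_chain (w:=w') Cm.1).
  apply: nw'; exists e => //; apply: (chain_inf fr Cm Mw' Fw') => c Cc Fc.
  rewrite joinC; apply: hU; first by exists c.
  by apply: contrapT => nc; apply: all; exists c.
have [c [Cc Fc cc1 cc2]] : exists c, [/\ C c, F c, c <= c1 & c <= c2].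
  by have [le|le] := Cm.1 _ _ Cc1 Cc2; [exists c1|exists c2].
exists c; split=> //.
have bc : below A (c `|` w').
  by apply: (@below_le _ _ _ _ (c2 `|` w')); [exact: leU2|exact: not_above_below].
have := climb_ge_below Fc Mw' Fw' bc.
have := rank_le Fc Fc1 cc1.
have := rank_le Fw' (joinF Fc Mw' Fw') (leUr _ _); lra.
Qed.

(** Every value of [climb] occurs on every maximal chain, and below [A]: between
    a high value on [C] and the zero at the element of [A] on [C]. *)
Lemma climb_onto C x : maximal_chain C -> F x ->
  exists c, [/\ C c, F c, below A c & s c = s x].
Proof.
move=> Cm Fx; have [a [Ca Aa]] := (cutsetA fr).2 _ Cm.
have Fa := cutset_finite fr Aa.
have sa : s a = 0 by apply: climb_above => //; exists a.
have := climb_ge0 Fx; rewrite le_eqVlt => /orP[/eqP sx|sx].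
  by exists a; split=> //; [exists a|rewrite sa].
have [c [Cc Fc sc]] := climb_cofinal Cm Fx.
have [||z [Cz Fz sz]] := climb_ivt Cm Cc Fc Ca Fa (ltW sx); rewrite ?sa //.
exists z; split=> //; apply: not_above_below => /(climb_above Fz) e.
by move: sx; rewrite -sz e ltxx.
Qed.

Lemma climb_gt0 x : F x -> ~ above A x -> 0 < s x.
Proof.
move=> Fx nx; have [a Aa xa] := not_above_below nx.
have Fa := cutset_finite fr Aa.
have aa : above A a by exists a.
rewrite -(climb_above Fa aa); apply: climb_strict => //; last by exists a.
by rewrite lt_neqAle xa andbT; apply/eqP => e; apply: nx; rewrite e.
Qed.

End Climb.

(** * Gradings *)

Section Gradings.
Context {d : Order.disp_t} {K : realType}.

(** The range of values need not be described: it is enough that every maximal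
    chain exhausts it. *)
Lemma grading_intro (P : porderType d) (sigma : P -> \bar K) :
  (forall x y, x < y -> sigma x < sigma y) ->
  (forall C x, maximal_chain C -> exists2 c, C c & sigma c = sigma x) ->
  grading sigma.
Proof.
move=> lt onto; exists (range sigma); split; first by move=> x; exists x.
move=> C Cm.
have mono x y : C x -> C y -> (sigma x <= sigma y) = (x <= y).
  move=> Cx Cy; apply/idP/idP => [le|].
    have [//|yx] := Cm.1 _ _ Cx Cy; move: yx; rewrite le_eqVlt => /orP[/eqP->//|/lt].
    by rewrite ltNge le.
  by rewrite le_eqVlt => /orP[/eqP->//|/lt/ltW].
split=> //; split; first by move=> x _; exists x.
- move=> x y /set_mem Cx /set_mem Cy e.
  by apply/eqP; rewrite eq_le -!mono // e lexx.
- by move=> _ [x _ <-]; have [c Cc e] := onto C x Cm; exists c.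
Qed.

Lemma grading_lt (P : porderType d) (R : set (\bar K)) (rho : P -> \bar K) x y :
  R_grading R rho -> x < y -> rho x < rho y.
Proof.
move=> [_ iso] xy; have [C Cm XC] := chain_extends (chain_pair (ltW xy)).
have Cx : C x by apply: XC; left.
have Cy : C y by apply: XC; right.
have [_ mono] := iso C Cm.
by rewrite ltNge mono //; apply/negP => yx; move: (lt_le_trans xy yx); rewrite ltxx.
Qed.

Lemma grading_onto (P : porderType d) (R : set (\bar K)) (rho : P -> \bar K) C l :
  R_grading R rho -> maximal_chain C -> R l -> exists2 c, C c & rho c = l.
Proof.
by move=> [_ iso] Cm Rl; have [[_ _ surj] _] := iso C Cm; have [c] := surj l Rl; exists c.
Qed.

Lemma grading_pinfty (L : latticeType d) (R : set (\bar K)) (rho : L -> \bar K) x y :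
  R_grading R rho -> rho x = +oo%E -> y <= x.
Proof.
move=> g rx; apply/join_idPr/eqP; rewrite eq_sym; apply/negPn/negP => ne.
have : x < y `|` x by rewrite lt_neqAle ne leUr.
by move/(grading_lt g); rewrite rx ltNge leey.
Qed.

Lemma grading_ninfty (L : latticeType d) (R : set (\bar K)) (rho : L -> \bar K) x y :
  R_grading R rho -> rho x = -oo%E -> x <= y.
Proof.
move=> g rx; apply/meet_idPl/eqP/negPn/negP => ne.
have : x `&` y < x by rewrite lt_neqAle ne leIl.
by move/(grading_lt g); rewrite rx ltNge leNye.
Qed.

Lemma grading_level_singleton (P : porderType d) (R : set (\bar K))
    (rho : P -> \bar K) (A : set P) a :
  R_grading R rho -> antichain A -> A a ->
  (forall x, a <= x) \/ (forall x, x <= a) -> level_set rho A.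
Proof.
move=> g anti Aa ext; exists (rho a); apply/seteqP; split=> x /=.
  by move=> Ax; case: ext => h; [rewrite (anti _ _ Aa Ax (h x))|rewrite (anti _ _ Ax Aa (h x))].
move=> e; suff -> : x = a by [].
have eq (u v : P) : u <= v -> rho u = rho v -> u = v.
  rewrite le_eqVlt => /orP[/eqP->//|/(grading_lt g)] + e'.
  by rewrite e' ltxx.
by case: ext => h; [apply/esym/eq|apply: eq].
Qed.

End Gradings.

(** * Rank supersolvable lattices *)

(** When [A] is neither the bottom nor the top, it has only elements of finite
    rank, and elements of infinite rank put no condition on the suprema and
    infima of the hypotheses. *)
Lemma chief_cut_frame (K : realType) (R : set (\bar K)) (hR : ereal_interval R)
    (d : Order.disp_t) (L : latticeType d) (rho : L -> \bar K)
    (hrho : R_grading R rho)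
    (m : R -> L) (hm : chief_chain rho (range m))
    (hrhom : forall l : R, rho (m l) = val l)
    (hsupc : forall (C : set L) (l0 : R), maximal_chain C ->
       supremums [set m l0 `&` c | c in [set c | C c /\ (rho c < +oo)%E]] (m l0))
    (hinfc : forall (C : set L) (l0 : R), maximal_chain C ->
       infimums [set m l0 `|` c | c in [set c | C c /\ (-oo < rho c)%E]] (m l0))
    (hsupz : forall z : L,
       supremums [set m l `&` z | l in [set l : R | (val l < +oo)%E]] z)
    (hinfz : forall z : L,
       infimums [set m l `|` z | l in [set l : R | (-oo < val l)%E]] z)
    (A : set L) :
  antichain_cutset A ->
  (forall a, A a -> exists x, ~ a <= x) ->
  (forall a, A a -> exists x, ~ x <= a) ->
  cut_frame [set x | rho x \is a fin_num] (fun x => fine (rho x)) (range m) A.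
Proof.
move=> cutA nbot ntop.
have finite_cases x : [\/ rho x \is a fin_num,
    rho x = +oo%E /\ (forall y, y <= x) | rho x = -oo%E /\ (forall y, x <= y)].
  case e: (rho x) => [l| |]; first by constructor 1.
  - by constructor 2; split=> // y; exact: grading_pinfty hrho e.
  - by constructor 3; split=> // y; exact: grading_ninfty hrho e.
have Afin : A `<=` [set x | rho x \is a fin_num].
  move=> a Aa; have [//|[_ top]|[_ bot]] := finite_cases a.
  - by have [x] := ntop a Aa; case; exact: top.
  - by have [x] := nbot a Aa; case; exact: bot.
have fineK_ x : rho x \is a fin_num -> (fine (rho x))%:E = rho x by exact: fineK.
split=> //.
- by move=> x y Fx Fy /(grading_lt hrho) h; rewrite -lte_fin !fineK_.
- move=> C x Cm Fx; have [c Cc e] := grading_onto hrho Cm (hrho.1 x).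
  by exists c; split; rewrite /= ?e.
- move=> C x y v Cm Cx Fx Cy Fy xv vy.
  have Rv : R v%:E.
    apply: (hR _ _ (hrho.1 x) (hrho.1 y)).
    by rewrite -(fineK_ x) // -(fineK_ y) // !lee_fin xv.
  by have [c Cc e] := grading_onto hrho Cm Rv; exists c; split; rewrite /= ?e.
- exact: hm.1.
- move=> x w Fx Mw Fw /=.
  have [|inc] := boolP (x >=< w).
    rewrite /Order.comparable => /orP[h|h].
      by rewrite (join_idPr h) (meet_idPl h); split=> //; rewrite addrC.
    by rewrite (join_idPl h) (meet_idPr h).
  have [_ _ e] := hm.2 w Mw x inc.
  have : (rho (x `|` w) + rho (x `&` w))%E \is a fin_num by rewrite e fin_numD Fx Fw.
  rewrite fin_numD => /andP[Fj Fm]; split=> //.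
  by rewrite -!fineD // e.
- move=> z e h; apply: (hinfz z).2 => _ [l /= lfin <-]; rewrite joinC.
  have [Fm|[rl top]|[rl bot]] := finite_cases (m l).
  + by apply: h => //; exists l.
  + exact: le_trans (top _) (leUr _ _).
  + by move: lfin; rewrite -hrhom rl ltxx.
- move=> z e h; apply: (hsupz z).2 => _ [l /= lfin <-]; rewrite meetC.
  have [Fm|[rl top]|[rl bot]] := finite_cases (m l).
  + by apply: h => //; exists l.
  + by move: lfin; rewrite -hrhom rl ltxx.
  + exact: le_trans (leIr _ _) (bot _).
- move=> C _ e Cm [l _ <-] Fl h; apply: (hinfc C l Cm).2 => _ [c /= [Cc cfin] <-].
  have [Fc|[rc top]|[rc bot]] := finite_cases c.
  + exact: h.
  + exact: le_trans (top _) (leUr _ _).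
  + by move: cfin; rewrite rc ltxx.
- move=> C _ e Cm [l _ <-] Fl h; apply: (hsupc C l Cm).2 => _ [c /= [Cc cfin] <-].
  have [Fc|[rc top]|[rc bot]] := finite_cases c.
  + exact: h.
  + by move: cfin; rewrite rc ltxx.
  + exact: le_trans (leIr _ _) (bot _).
Qed.

Theorem theorem4p1 (K : realType) (R : set (\bar K)) (hR : ereal_interval R)
    (d : Order.disp_t) (L : latticeType d) (rho : L -> \bar K)
    (hrho : R_grading R rho)
    (m : R -> L) (hm : chief_chain rho (range m))
    (hrhom : forall l : R, rho (m l) = val l)
    (hsupc : forall (C : set L) (l0 : R), maximal_chain C ->
       supremums [set m l0 `&` c | c in [set c | C c /\ (rho c < +oo)%E]] (m l0))
    (hinfc : forall (C : set L) (l0 : R), maximal_chain C ->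
       infimums [set m l0 `|` c | c in [set c | C c /\ (-oo < rho c)%E]] (m l0))
    (hsupz : forall z : L,
       supremums [set m l `&` z | l in [set l : R | (val l < +oo)%E]] z)
    (hinfz : forall z : L,
       infimums [set m l `|` z | l in [set l : R | (-oo < val l)%E]] z)
    (A : set L) (hA : antichain_cutset A) :
  exists sigma : L -> \bar K, grading sigma /\ level_set sigma A.
Proof.
have [[a Aa ext]|next] := pselect (exists2 a, A a &
    (forall x, a <= x) \/ (forall x, x <= a)).
  exists rho; split; first by exists R.
  exact: grading_level_singleton hrho hA.1 Aa ext.
pose F := [set x | rho x \is a fin_num].
pose r x := fine (rho x).
have fr : cut_frame F r (range m) A.
  apply: chief_cut_frame => // a Aa; apply: contrapT => all; apply: next.
    by exists a => //; left=> x; apply: contrapT => nx; apply: all; exists x.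
  by exists a => //; right=> x; apply: contrapT => nx; apply: all; exists x.
have frd := cut_frame_dual fr.
pose s := climb F r (range m) A.
pose t : L -> K := @climb _ L^d K F (fun x => - r x)%R (range m) A.
have s0 x : F x -> above A x -> s x = 0%R by exact: climb_above.
have t0 x : F x -> below A x -> t x = 0%R by exact: (climb_above frd).
have s1 x : F x -> ~ above A x -> (0 < s x)%R by exact: climb_gt0.
have t1 x : F x -> ~ below A x -> (0 < t x)%R by exact: (climb_gt0 frd).
have split_ x : above A x \/ below A x by exact: above_or_below.
pose sigma x := if pselect (F x) then (t x - s x)%:E else rho x.
have sigF x : F x -> sigma x = (t x - s x)%:E by rewrite /sigma; case: pselect.
have sigN x : ~ F x -> sigma x = rho x by rewrite /sigma; case: pselect.
have infinite x : ~ F x -> rho x = +oo%E \/ rho x = -oo%E.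
  by rewrite /F /=; case: (rho x) => [l /(_ isT)| |] //; [left|right].
exists sigma; split.
  apply: grading_intro => [x y xy|C x Cm].
    have rxy := grading_lt hrho xy.
    have [Fx|nFx] := pselect (F x); last first.
      rewrite (sigN x nFx); have [rx|rx] := infinite x nFx.
        by move: rxy; rewrite rx ltNge leey.
      rewrite rx; have [Fy|nFy] := pselect (F y); first by rewrite sigF // ltNyr.
      by rewrite sigN // -rx.
    have [Fy|nFy] := pselect (F y); last first.
      rewrite (sigN y nFy); have [ry|ry] := infinite y nFy; rewrite ry.
        by rewrite sigF // ltry.
      by move: rxy; rewrite ry ltNge leNye.
    rewrite !sigF // lte_fin.
    have [byy|nby] := pselect (below A y).
      have bx := below_le (ltW xy) byy.
      rewrite !t0 // !sub0r ltrN2; exact: (climb_strict fr).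
    have ay : above A y by have [] := split_ y.
    rewrite (s0 y) // subr0.
    have [ax|nax] := pselect (above A x).
      rewrite (s0 x) // subr0; exact: (climb_strict frd).
    have bx : below A x by have [] := split_ x.
    rewrite (t0 x) // sub0r; apply: lt_trans (t1 _ Fy nby).
    by rewrite oppr_lt0; exact: s1.
  have [Fx|nFx] := pselect (F x); last first.
    have [c Cc e] := grading_onto hrho Cm (hrho.1 x).
    by exists c => //; rewrite !sigN // /F /= e.
  have [ax|bx] := split_ x.
    have [c [Cc Fc ac e]] := climb_onto frd (maximal_chain_dual Cm) Fx.
    by exists c => //; rewrite !sigF // !s0 // !subr0; congr (_%:E).
  have [c [Cc Fc bc e]] := climb_onto fr Cm Fx.
  by exists c => //; rewrite !sigF // !t0 // !sub0r; congr (- _)%:E.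
exists 0%:E; apply/seteqP; split=> x /=.
  move=> Ax; have Fx := cutset_finite fr Ax.
  by rewrite sigF // s0 ?t0 ?subr0 //; exists x.
have [Fx|nFx] := pselect (F x); last first.
  by rewrite sigN //; have [->|->] := infinite x nFx.
rewrite sigF // => -[] e.
have [ax|nax] := pselect (above A x); last first.
  have bx : below A x by have [] := split_ x.
  by move: e (s1 x Fx nax); rewrite t0 // sub0r => /eqP; rewrite oppr_eq0 => /eqP ->; rewrite ltxx.
have [bx|nbx] := pselect (below A x); first exact: above_below hA.1 ax bx.
by move: e (t1 x Fx nbx); rewrite s0 // subr0 => ->; rewrite ltxx.
Qed.
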